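(* Let $(X,Y,A,f,h)$ satisfy the standing assumptions in the context. Suppose $\gamma>1$ is such that $f\circ A$ has $\gamma$-curvature relative to $h$ with constant $C$ (defined in the context). Let $(x_k,u_k,s_k)$, $k=0,1,2,\dots$, be the iterates generated by the generalized conditional subgradient algorithm for $\min_{x\in X}\{f(Ax)+h(x)\}$ (defined in the context), where $\alpha_0=1$ and for $k=1,2,\dots$ the step size $\alpha_k\in[0,1]$ is chosen by the line search $$\alpha_k\in\operatorname*{argmin}_{\alpha\in[0,1]}\bigl\{(1-\alpha)\,G_k+D_f(A(x_k+\alpha(s_k-x_k)),Ax_k)\bigr\},$$ with $G_1=D_f(As_0,Ax_0)$ and $G_{k+1}=(1-\alpha_k)G_k+D_f(A((1-\alpha_k)x_k+\alpha_ks_k),Ax_k)$ for $k=1,2,\dots$. Then for all $k=1,2,\dots$ $$f(Ax_k)+h(x_k)+f^*(\hat u_k)+h^*(-A^*\hat u_k)\le C\left(\frac{\gamma}{k+\gamma}\right)^{\gamma-1},$$ where $\hat u_k$ is either of the following: $\hat u_k=\sum_{i=0}^{k-1}\lambda_i^ku_i$, or $\hat u_k$ is an element of $\{u_0,\dots,u_{k-1}\}$ minimizing $f^*(u_i)+h^*(-A^*u_i)$.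
   Context: Setting. $X,Y$ are finite-dimensional real vector spaces with duals $X^*,Y^*$ and pairings $\langle\cdot,\cdot\rangle$; $A:X\to Y$ is linear with adjoint $A^*:Y^*\to X^*$; $f:Y\to\mathbb{R}\cup\{\infty\}$ and $h:X\to\mathbb{R}\cup\{\infty\}$ are proper closed convex functions with Fenchel conjugates $f^*:Y^*\to\mathbb{R}\cup\{\infty\}$, $h^*:X^*\to\mathbb{R}\cup\{\infty\}$. $\operatorname{dom}(\partial f)\subseteq Y$ and $\operatorname{dom}(\partial h^* )\subseteq X^*$ are the sets of points at which the respective subdifferential is nonempty. Single-valued oracles are fixed: for each $y\in\operatorname{dom}(\partial f)$, $\partial f(y)\in Y^*$ denotes one fixed chosen element of $\operatorname{argmax}_{v\in Y^*}\{\langle v,y\rangle-f^*(v)\}$ (the subdifferential of $f$ at $y$); for each $u\in\operatorname{dom}(\partial h^* )$, $\partial h^*(u)\in X$ denotes one fixed chosen element of $\operatorname{argmax}_{x\in X}\{\langle u,x\rangle-h(x)\}$ (the subdifferential of $h^*$ at $u$). Standing assumption: $-A^*\partial f(y)\in\operatorname{dom}(\partial h^* )$ for all $y\in\operatorname{dom}(\partial f)$, and $A\,\partial h^*(u)\in\operatorname{dom}(\partial f)$ for all $u\in\operatorname{dom}(\partial h^* )$. Generalized Bregman distance: $D_f(y,w)=f(y)-f(w)-\langle\partial f(w),y-w\rangle$ for $w\in\operatorname{dom}(\partial f)$, $y\in\operatorname{dom}(f)$, with the chosen subgradient. Relative $\gamma$-curvature: $f\circ A$ has $\gamma$-curvature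 relative to $h$ with (finite) constant $C$ if for all $x\in X$ with $Ax\in\operatorname{dom}(\partial f)$ and all $v\in\operatorname{dom}(\partial h^* )$, with $s=\partial h^*(v)$, one has $D_f(A(x+\alpha(s-x)),Ax)\le C\alpha^\gamma/\gamma$ for all $\alpha\in[0,1]$. Generalized conditional subgradient algorithm: given $x_0\in X$ with $Ax_0\in\operatorname{dom}(\partial f)$, for $k=0,1,2,\dots$: $u_k:=\partial f(Ax_k)$, $s_k:=\partial h^*(-A^*u_k)$, pick $\alpha_k\in[0,1]$, $x_{k+1}:=(1-\alpha_k)x_k+\alpha_ks_k$. The iterates are understood to be well defined, i.e. $Ax_k\in\operatorname{dom}(\partial f)$ for all $k$. Weights: for $k=0,1,2,\dots$, $\lambda^{k+1}_k=\alpha_k$ and $\lambda^{k+1}_i=(1-\alpha_k)\lambda^k_i$ for $i=0,\dots,k-1$. *)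

(* Defs.v *)
From HB Require Import structures.
From mathcomp Require Export all_boot all_order all_algebra.
From mathcomp Require Export all_classical all_reals all_analysis.

Set Implicit Arguments.
Unset Strict Implicit.
Unset Printing Implicit Defensive.

Export Order.TTheory GRing.Theory Num.Theory.
Export numFieldNormedType.Exports.

Global Open Scope classical_set_scope.
Global Open Scope ring_scope.

Definition dual (R : realType) (V : vectType R) : vectType R := 'Hom(V, R^o).

Definition adjoint (R : realType) (X Y : vectType R) (A : 'Hom(X, Y))
    (u : dual Y) : dual X :=
  (u \o A)%VF.

Definition argmax (R : realType) (T : Type) (D : set T) (g : T -> \bar R) :
    set T :=
  [set t | D t /\ forall t', D t' -> (g t' <= g t)%E].

Definition argmin (R : realType) (T : Type) (D : set T) (g : T -> \bar R) :
    set T :=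
  [set t | D t /\ forall t', D t' -> (g t <= g t')%E].

Section convex_analysis.
Context {R : realType}.
Implicit Type V : vectType R.
Local Open Scope ereal_scope.

Definition proper V (f : V -> \bar R) :=
  (forall y, f y != -oo) /\ (exists y, f y < +oo).

Definition econvex V (f : V -> \bar R) :=
  forall (y z : V) (t : R), (0 <= t <= 1)%R ->
    f (t *: y + (1 - t) *: z)%R <= t%:E * f y + (1 - t)%:E * f z.

(* A vectType carries no topology of its own: semicontinuity is read in the
   coordinates of a basis, the linear isomorphism with R^n that induces the
   standard topology. *)
Definition closed_fun V (f : V -> \bar R) :=
  lower_semicontinuous (f \o passmx.vecof (vbasis {:V})).

Definition proper_closed_convex V (f : V -> \bar R) :=
  [/\ proper f, closed_fun f & econvex f].

Definition conjugate V (f : V -> \bar R) (v : dual V) : \bar R :=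
  ereal_sup (range (fun y : V => (v y : R)%:E - f y)).

Definition subdiff V (f : V -> \bar R) (y : V) : set (dual V) :=
  argmax setT (fun v : dual V => (v y : R)%:E - conjugate f v).

(* The subdifferential of the conjugate of h, as a subset of V rather than of
   its bidual. *)
Definition subdiff_conj V (h : V -> \bar R) (u : dual V) : set V :=
  argmax setT (fun x : V => (u x : R)%:E - h x).

Definition dom_subdiff V (f : V -> \bar R) : set V :=
  [set y | subdiff f y !=set0].

Definition dom_subdiff_conj V (h : V -> \bar R) : set (dual V) :=
  [set u | subdiff_conj h u !=set0].

Definition bregman V (f : V -> \bar R) (df : V -> dual V) (y w : V) : \bar R :=
  f y - f w - (df w (y - w)%R : R)%:E.

End convex_analysis.

Section conditional_subgradient.
Context {R : realType} {X Y : vectType R}.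
Variables (A : 'Hom(X, Y)) (f : Y -> \bar R) (h : X -> \bar R).
(* The values of df and dh outside dom_subdiff f and dom_subdiff_conj h are
   irrelevant. *)
Variables (df : Y -> dual Y) (dh : dual X -> X).

Definition oracles :=
  (forall y, dom_subdiff f y -> subdiff f y (df y)) /\
  (forall u, dom_subdiff_conj h u -> subdiff_conj h u (dh u)).

Definition compatible_oracles :=
  (forall y, dom_subdiff f y -> dom_subdiff_conj h (- adjoint A (df y))) /\
  (forall u, dom_subdiff_conj h u -> dom_subdiff f (A (dh u))).

Definition relative_curvature (gamma C : R) :=
  forall (x : X) (v : dual X),
    dom_subdiff f (A x) -> dom_subdiff_conj h v ->
    forall a : R, 0 <= a <= 1 ->
      (bregman f df (A (x + a *: (dh v - x))%R) (A x)
         <= (C * a `^ gamma / gamma)%:E)%E.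

Definition cond_subgrad_iterates (alpha : nat -> R)
    (x : nat -> X) (u : nat -> dual Y) (s : nat -> X) :=
  forall k : nat,
    [/\ dom_subdiff f (A (x k)),
        u k = df (A (x k)),
        s k = dh (- adjoint A (u k)),
        0 <= alpha k <= 1
      & x k.+1 = (1 - alpha k) *: x k + alpha k *: s k].

(* G 0 is unconstrained. *)
Definition line_search (alpha : nat -> R) (x s : nat -> X) (G : nat -> \bar R) :=
  [/\ alpha 0%N = 1,
      G 1%N = bregman f df (A (s 0%N)) (A (x 0%N)),
      (forall k : nat, (1 <= k)%N ->
         argmin [set a : R | 0 <= a <= 1]
           (fun a => ((1 - a)%:E * G k
              + bregman f df (A (x k + a *: (s k - x k))%R) (A (x k)))%E)
           (alpha k))
    & forall k : nat, (1 <= k)%N ->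
         G k.+1 = ((1 - alpha k)%:E * G k
           + bregman f df (A ((1 - alpha k) *: x k + alpha k *: s k)%R)
                     (A (x k)))%E].

Definition dual_objective (v : dual Y) : \bar R :=
  (conjugate f v + conjugate h (- adjoint A v)%R)%E.

End conditional_subgradient.

(* Only the values with i < k are meaningful. *)
Fixpoint weight (R : realType) (alpha : nat -> R) (k i : nat) : R :=
  if k is j.+1 then
    if i == j then alpha j else (1 - alpha j) * weight alpha j i
  else 0.

(* Main.v *)
Require Import Defs.
From mathcomp Require Import ring lra.

(* With a_i = f(A x_i) and b_i = h(s_i), the Fenchel equalities at u_i and s_i
   turn f^*(u_i) + h^*(-A^* u_i) into -a_i - <u_i, A(s_i - x_i)> - b_i, and
   convexity of h then bounds the duality gap at step k by G_k.  Taking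
   alpha = gamma/(k + gamma) in the line search gives the rate, through
   1 - p/n <= (n/(n+1))^p.

   The Fenchel equality for f needs f = f^** at points where f^** has a
   subgradient.  For r < f(y), compactness and lower semicontinuity make f
   dominate a cone r - N|. - y|, so that the infimal convolution of f with the
   cone is finite, and a Hahn-Banach extension in the coordinates of a basis
   yields an affine minorant of f with value r at y. *)

Import passmx.

Set Implicit Arguments.
Unset Strict Implicit.
Unset Printing Implicit Defensive.

(** * Lower semicontinuity and cone minorants *)

Lemma lsc_bounded_below_compact (R : realType) (T : ptopologicalType)
    (F : T -> \bar R) (K : set T) :
  (forall x, F x != -oo%E) -> lower_semicontinuous F -> compact K ->
  exists m : R, forall x, K x -> (m%:E <= F x)%E.
Proof.
move=> Fny lscF /compact_near_coveringP cK.
(* Locally [F] exceeds a finite constant; a bound stated as eventual in [N] becomes uniform on [K]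
   by the near-covering form of compactness. *)
have : \forall N \near +oo_R, K `<=` (fun x => ((- N)%:E <= F x)%E).
  apply: cK => x Kx.
  have [c cF] : exists c : R, (c%:E < F x)%E.
    move: (Fny x); case: (F x) => [r| |]//= _; last by exists 0; rewrite ltry.
    by exists (r - 1); rewrite lte_fin; lra.
  have [V xV VF] := lscF _ _ cF.
  exists (V, [set N | - c <= N]).
    by split => //=; apply: nbhs_pinfty_ge; exact: num_real.
  move=> [z N] [/= /VF cz cN].
  by apply: le_trans (ltW cz); rewrite lee_fin; lra.
by case/pinfty_ex_gt0 => N _ KN; exists (- N).
Qed.

Lemma econvex_le (R : realType) (V : vectType R) (f : V -> \bar R)
    (y z : V) (a b t : R) :
  econvex f -> 0 <= t <= 1 -> (f y <= a%:E)%E -> (f z <= b%:E)%E ->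
  (f (t *: y + (1 - t) *: z)%R <= (t * a + (1 - t) * b)%:E)%E.
Proof.
move=> cf t01 fy fz; apply: le_trans (cf _ _ _ t01) _.
by rewrite [leRHS]EFinD !EFinM leeD// lee_wpmul2l// lee_fin; lra.
Qed.

(** Near [y] lower semicontinuity keeps [F] above [r]; far away convexity allows at most linear
    descent. A steep enough cone covers both regimes. *)
Lemma convex_lsc_cone_minorant (R : realType) (n : nat) (F : 'rV[R]_n -> \bar R)
    (y : 'rV[R]_n) (r : R) :
  proper F -> lower_semicontinuous F -> econvex F -> (r%:E < F y)%E ->
  exists2 N : R, 0 <= N &
    forall w b, (F w <= b%:E)%E -> r <= b + N * `|w - y|.
Proof.
move=> [Fny [w0 Fw0]] lscF cvxF rF.
have [c0 Fc0] : exists c0, F w0 = c0%:E.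
  by move: Fw0 (Fny w0); case: (F w0) => [c| |]// _ _; exists c.
have cB : compact [set p : 'rV[R]_n | `|w0 - p| <= 1].
  apply: bounded_closed_compact; last exact: (@closed_closed_ball_ R _ w0 1).
  exists (1 + `|w0|); split; first exact: num_real.
  move=> M hM p /= hp; apply: le_trans (ltW hM).
  by rewrite -[p](subrK w0) (le_trans (ler_normD _ _))// lerD2r distrC.
have [m mF] := lsc_bounded_below_compact Fny lscF cB.
have mc0 : m <= c0.
  by rewrite -lee_fin -Fc0; apply: mF; rewrite /= subrr normr0 ler01.
(* A point at distance [d > 1] from [w0] is pulled back to the unit sphere around [w0] with weight
   [d^-1]; comparing [m] there with [c0] at [w0] bounds the descent. *)
have far w b : (F w <= b%:E)%E -> m - (c0 - m) * `|w - w0| <= b.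
  move=> Fwb; have [le1|gt1] := leP `|w - w0| 1.
    have : m <= b by rewrite -lee_fin (le_trans (mF w _) Fwb)//= distrC.
    by have := normr_ge0 (w - w0); nra.
  set d := `|w - w0| in gt1 *.
  have d0 : 0 < d by lra.
  have t01 : 0 <= d^-1 <= 1 by rewrite invr_ge0 ltW//= invf_le1// ltW.
  have : (m%:E <= F (d^-1 *: w + (1 - d^-1) *: w0)%R)%E.
    apply: mF => /=; rewrite distrC.
    have -> : d^-1 *: w + (1 - d^-1) *: w0 - w0 = d^-1 *: (w - w0).
      by rewrite scalerBr scalerBl scale1r addrA addrAC addrK.
    by rewrite normrZ gtr0_norm ?invr_gt0// mulVf// gt_eqF.
  have Fc0' : (F w0 <= c0%:E)%E by rewrite Fc0.
  move=> /le_trans/(_ (econvex_le cvxF t01 Fwb Fc0')).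
  rewrite lee_fin -(ler_pM2l d0) mulrDr !mulrA mulrBr divff ?gt_eqF//.
  rewrite mulr1 mul1r.
  nra.
have [V yV VF] := lscF _ _ rF.
have [d dV] := nbhs_ex yV; pose e := d%:num.
pose a := m - (c0 - m) * `|y - w0|.
have e0 : 0 < e by rewrite /e.
have q0 : 0 <= `|r - a| / e by rewrite divr_ge0// ltW.
(* The slope [c0 - m] carries the bound [far] from [w0] to [y] by the triangle inequality; the other
   term makes up the deficit [r - a] once [w] is at distance at least [e] from [y]. *)
exists (c0 - m + `|r - a| / e); first by lra.
move=> w b Fwb.
have := normr_ge0 (w - y).
have [le1|gt1] := ltP `|w - y| e.
  have : r < b.
    rewrite -lte_fin (lt_le_trans _ Fwb)//; apply/VF/dV.
    by rewrite -ball_normE/= distrC.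
  nra.
have := far _ _ Fwb.
have tri : `|w - w0| <= `|w - y| + `|y - w0|.
  by rewrite (le_trans _ (ler_normD _ _))// addrA subrK.
have : r - a <= `|r - a| / e * `|w - y|.
  rewrite (le_trans (ler_norm _))// mulrAC -mulrA ler_peMr//.
  by rewrite ler_pdivlMr ?mul1r.
rewrite /a; nra.
Qed.

(** * Hahn-Banach extension and affine minorants *)

(* [Q] plays the role of the epigraph of a real-valued convex function. *)
Lemma convex_epigraph_extension (R : realType) (V : lmodType R)
    (Q : V -> R -> Prop) (U : V -> Prop) (e : V) :
  (forall y z a b t, 0 <= t <= 1 -> Q y a -> Q z b ->
     Q (t *: y + (1 - t) *: z) (t * a + (1 - t) * b)) ->
  (forall z, exists c, Q z c) ->
  U 0 ->
  (forall y z t, U y -> U z -> U (t *: y + (1 - t) *: z)) ->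
  (forall z c, U z -> Q z c -> 0 <= c) ->
  exists t : R, forall z a c, U z -> Q (z + a *: e) c -> t * a <= c.
Proof.
move=> cvxQ totQ U0 cvxU Q0.
(* [T] collects the lower bounds that points on the negative side of [e] impose on the slope [t];
   points on the positive side impose upper bounds, and [sup T] meets both. *)
pose T : set R := fun q => exists w b c,
  [/\ U w, 0 < b, Q (w - b *: e) c & q = - c / b].
have TP z a c : U z -> 0 < a -> Q (z + a *: e) c -> ubound T (c / a).
  move=> Uz a0 Qc _ [w [b [d [Uw b0 Qd ->]]]].
  (* The weights [b / (a + b)] and [a / (a + b)] cancel the [e] components, so the combination lies
     in [U], where [Q] is nonnegative. *)
  have ab0 : 0 < a + b by lra.
  have t01 : 0 <= b / (a + b) <= 1.
    by rewrite ler_pdivrMr// mul1r divr_ge0/=; lra.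
  have E : 1 - b / (a + b) = a / (a + b).
    by field; rewrite gt_eqF.
  have := Q0 _ _ _ (cvxQ _ _ _ _ _ t01 Qc Qd).
  rewrite E.
  have -> : (b / (a + b)) *: (z + a *: e) + (a / (a + b)) *: (w - b *: e)
     = (b / (a + b)) *: z + (1 - b / (a + b)) *: w.
    rewrite E !scalerDr scalerN !scalerA addrACA.
    have -> : b / (a + b) * a = a / (a + b) * b by ring.
    by rewrite subrr addr0.
  move=> /(_ (cvxU _ _ _ Uz Uw)).
  have -> : b / (a + b) * c + a / (a + b) * d = (b * c + a * d) / (a + b).
    by ring.
  rewrite pmulr_lge0 ?invr_gt0// => H.
  by rewrite ler_pdivrMr// mulrAC ler_pdivlMr//; lra.
have T0 : T !=set0.
  have [c Qc] := totQ (0 - 1 *: e).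
  by exists (- c / 1), 0, 1, c; split => //; exact: ltr01.
have Tub : has_ubound T.
  have [c Qc] := totQ (0 + 1 *: e).
  by exists (c / 1); apply: (TP 0) => //; exact: ltr01.
exists (sup T) => z a c Uz.
have [a0|a0|->] := ltgtP a 0.
- rewrite -[a]opprK scaleNr => Qc.
  have : - c / - a <= sup T.
    apply: ub_le_sup => //; exists z, (- a), c; split => //; lra.
  by rewrite ler_pdivrMr ?oppr_gt0//; lra.
- by move=> Qc; rewrite -ler_pdivlMr//; apply: ge_sup => //; exact: TP Qc.
- by rewrite scale0r addr0 mulr0; exact: Q0.
Qed.

(** The functional is built by induction on the basis vectors: [U k] is the span of the first [k] of
    them, and each step fixes one more slope. *)
Lemma convex_epigraph_minorant (R : realType) (V : vectType R)
    (Q : V -> R -> Prop) :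
  (forall y z a b t, 0 <= t <= 1 -> Q y a -> Q z b ->
     Q (t *: y + (1 - t) *: z) (t * a + (1 - t) * b)) ->
  (forall z, exists c, Q z c) ->
  (forall c, Q 0 c -> 0 <= c) ->
  exists v : dual V, forall z c, Q z c -> v z <= c.
Proof.
move=> cvxQ totQ Q0.
pose e := vbasis {:V}.
pose U k (z : V) := forall i : 'I_(\dim {:V}), (k <= i)%N -> coord e i z = 0.
suff /(_ (\dim {:V}) (leqnn _)) [v vP] : forall k, (k <= \dim {:V})%N ->
    exists v : dual V, forall z c, U k z -> Q z c -> v z <= c.
  by exists v => z c; apply: vP => i; rewrite leqNgt ltn_ord.
elim=> [_|k IH kn].
  exists 0 => z c Uz Qz; rewrite lfunE/=; apply: Q0.
  rewrite (coord_vbasis (memvf z)) in Qz.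
  by rewrite big1 in Qz => // i _; rewrite Uz// scale0r.
have [v vP] := IH (ltnW kn).
pose i0 := Ordinal kn.
(* Subtracting the functional found so far reduces the extension to the case where it vanishes on
   [U k]. *)
pose Qv z c := Q z (c + v z).
have ce i : coord e i e`_i0 = (i0 == i)%:R.
  exact: coord_free (basis_free (vbasisP _)).
have [|||||t tP] := @convex_epigraph_extension R V Qv (U k) e`_i0.
- move=> y z a b t t01 Qy Qz; rewrite /Qv.
  have -> : t * a + (1 - t) * b + v (t *: y + (1 - t) *: z) =
      t * (a + v y) + (1 - t) * (b + v z).
    by rewrite linearD !linearZ/= /GRing.scale/=; ring.
  exact: cvxQ.
- move=> z; have [c Qc] := totQ z; exists (c - v z).
  by rewrite /Qv subrK.
- by move=> i _; rewrite linear0.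
- by move=> y z t Uy Uz i ki; rewrite linearD !linearZ/= Uy// Uz// !mulr0 addr0.
- by move=> z c Uz /(vP _ _ Uz); lra.
pose w : dual V := linfun (coord e i0 : V -> R^o).
exists (v + t *: w) => z c Uz Qc.
pose a := coord e i0 z.
have Uz' : U k (z - a *: e`_i0).
  move=> i; rewrite leq_eqVlt => /orP[/eqP ki|ki].
    have -> : i = i0 by apply/val_inj.
    rewrite linearB linearZ/= ce eqxx.
    by rewrite mulr1 subrr.
  rewrite linearB linearZ/= ce Uz//.
  by rewrite -val_eqE/= (ltn_eqF ki) mulr0 subr0.
have := tP (z - a *: e`_i0) a (c - v z) Uz'.
rewrite /Qv !subrK => /(_ Qc).
by rewrite !lfunE/= lfunE/= lfunE/= /GRing.scale/= -/a; lra.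
Qed.

Lemma affine_minorant (R : realType) (V : vectType R) (f : V -> \bar R)
    (y : V) (r : R) :
  proper_closed_convex f -> (r%:E < f y)%E ->
  exists v : dual V, forall w, ((r + v (w - y))%:E <= f w)%E.
Proof.
case=> [[fny [y0 fy0]] lscf cvxf] rf.
pose e := vbasis {:V}.
have basise : basis_of fullv e := vbasisP _.
(* The norm on [V] is the norm of the coordinates, matching the reading of semicontinuity in
   [closed_fun]. *)
pose nu (z : V) := `|rVof e z|.
have nuD z z' : nu (z + z') <= nu z + nu z' by rewrite /nu linearD ler_normD.
have nuZ t z : nu (t *: z) = `|t| * nu z by rewrite /nu linearZ/= normrZ.
have [||||N N0 NP] :=
    @convex_lsc_cone_minorant R _ (f \o vecof e) (rVof e y) r.
- by split => [p|]; [exact: fny|exists (rVof e y0); rewrite /= rVofK].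
- exact: lscf.
- by move=> p q t t01 /=; rewrite linearD !linearZ/=; exact: cvxf.
- by rewrite /= rVofK.
have {}NP w b : (f w <= b%:E)%E -> r <= b + N * nu (w - y).
  by move=> fw; rewrite /nu linearB; apply: NP; rewrite /= rVofK.
(* The relation is the epigraph of the infimal convolution of [f] with the cone [N * nu], recentred
   at [y] and lowered by [r]; [NP] is its nonnegativity at 0. *)
have [|||v vP] := @convex_epigraph_minorant R V (fun z c =>
  exists w b, (f w <= b%:E)%E /\ b - r + N * nu (y + z - w) <= c).
- move=> z z' c c' t t01 [w [b [fw bc]]] [w' [b' [fw' bc']]].
  exists (t *: w + (1 - t) *: w'), (t * b + (1 - t) * b').
  split; first exact: econvex_le.
  have -> : y + (t *: z + (1 - t) *: z') - (t *: w + (1 - t) *: w') =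
      t *: (y + z - w) + (1 - t) *: (y + z' - w').
    have yE : y = t *: y + (1 - t) *: y.
      by rewrite -scalerDl addrC subrK scale1r.
    rewrite {1}yE !scalerBr !scalerDr opprD (addrACA (t *: y)).
    by rewrite (addrACA (t *: y + _)).
  have := nuD (t *: (y + z - w)) ((1 - t) *: (y + z' - w')).
  rewrite !nuZ !ger0_norm; [|lra|lra] => H.
  have := ler_wpM2l N0 H.
  nra.
- move=> z; case fb : (f y0) fy0 (fny y0) => [b| |]// _ _.
  by exists (b - r + N * nu (y + z - y0)), y0, b; rewrite fb.
- move=> c [w [b [fw]]]; have := NP _ _ fw.
  by rewrite addr0 /nu -opprB linearN normrN; lra.
exists v => w; case fb : (f w) (fny w) => [b| |]// _; last by rewrite leey.
rewrite lee_fin; have : v (w - y) <= b - r.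
  apply: vP; exists w, b; rewrite fb; split => //.
  by rewrite addrCA subrr addr0 subrr /nu linear0 normr0 mulr0 addr0.
lra.
Qed.

(** * Fenchel equalities and convexity of the conjugate *)

Lemma conjugate_neqNy (R : realType) (V : vectType R) (f : V -> \bar R)
    (v : dual V) : proper f -> conjugate f v != -oo%E.
Proof.
move=> [fny [y fy]].
have : ((v y : R)%:E - f y <= conjugate f v)%E.
  by apply: ereal_sup_ubound; exists y.
by move: (fny y) fy; case: (f y) => // a _ _; case: (conjugate f v).
Qed.

(** An affine minorant with slope [w] and value [r] at [y] has [conjugate f w] at most [w y - r].
    Maximality of [v] then bounds [v y - conjugate f v] below by every [r] under [f y], which is the
    reverse of Fenchel-Young. *)
Lemma subdiff_conjugateE (R : realType) (V : vectType R) (f : V -> \bar R)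
    (y : V) (v : dual V) :
  proper_closed_convex f -> subdiff f y v ->
  exists2 a : R, f y = a%:E & conjugate f v = ((v y : R) - a)%:E.
Proof.
move=> pf [_ vmax]; have [pr _ _] := pf; have [fny _] := pr.
have below r : (r%:E < f y)%E -> (r%:E <= (v y : R)%:E - conjugate f v)%E.
  move=> /(affine_minorant pf)[w wP].
  apply: le_trans (vmax w I).
  have : (conjugate f w <= ((w y : R) - r)%:E)%E.
    apply: ge_ereal_sup => _ [z _ <-]; have := wP z.
    case: (f z) (fny z) => [c| |]// _; last by rewrite leNye.
    by rewrite -EFinB !lee_fin linearB/=; lra.
  case: (conjugate f w) (conjugate_neqNy w pr) => [c| |]// _.
  by rewrite -EFinB !lee_fin; lra.
have : ((v y : R)%:E - f y <= conjugate f v)%E.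
  by apply: ereal_sup_ubound; exists y.
case: (f y) (fny y) below => [a| |]// _ below; last first.
  case: (conjugate f v) (conjugate_neqNy v pr) below => [c| |]// _ below _.
    by have := below ((v y : R) - c + 1) (ltry _); rewrite -EFinB lee_fin; lra.
  by have := below 0 (ltry _).
case: (conjugate f v) (conjugate_neqNy v pr) below => [c| |]// _ below.
  rewrite -EFinB lee_fin => ac; exists a => //; congr EFin.
  apply/eqP; rewrite eq_le ac andbT.
  rewrite leNgt; apply/negP => ca.
  (* If [v y - c < a], their midpoint lies below [f y] but above [v y - c], against [below]. *)
  have := below (((v y : R) - c + a) / 2); rewrite -EFinB lte_fin lee_fin; lra.
by have := below (a - 1); rewrite lte_fin => /(_ ltac:(lra)).
Qed.

(** The maximiser attains the very supremum that defines the conjugate, and properness makes the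
    value finite. *)
Lemma subdiff_conj_conjugateE (R : realType) (V : vectType R) (h : V -> \bar R)
    (u : dual V) (x : V) :
  proper h -> subdiff_conj h u x ->
  exists2 b : R, h x = b%:E & conjugate h u = ((u x : R) - b)%:E.
Proof.
move=> [hny [x0 hx0]] [_ xmax].
have hE : conjugate h u = ((u x : R)%:E - h x)%E.
  apply/eqP; rewrite eq_le; apply/andP; split.
    by apply: ge_ereal_sup => _ [z _ <-]; exact: xmax.
  by apply: ereal_sup_ubound; exists x.
have := xmax x0 I; rewrite hE.
move: (hny x) (hny x0) hx0; case: (h x) => [b| |]//;
  case: (h x0) => // a _ _ _ _.
by exists b.
Qed.

(** Jensen's inequality: for fixed [y] the term under the supremum is affine in the functional, so
    the bounds average. *)
Lemma conjugate_sum_le (R : realType) (V : vectType R) (f : V -> \bar R)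
    (k : nat) (w : 'I_k -> R) (u : 'I_k -> dual V) (c : 'I_k -> R) :
  (forall y, f y != -oo%E) -> (forall i, 0 <= w i) -> \sum_i w i = 1 ->
  (forall i, (conjugate f (u i) <= (c i)%:E)%E) ->
  (conjugate f (\sum_i w i *: u i) <= (\sum_i w i * c i)%:E)%E.
Proof.
move=> fny w0 w1 uc; apply: ge_ereal_sup => _ [y _ <-].
have {}uc i : ((u i y : R)%:E - f y <= (c i)%:E)%E.
  by apply: le_trans (uc i); apply: ereal_sup_ubound; exists y.
move: (fny y) uc; case: (f y) => [b| |]// _ uc; last by rewrite leNye.
have -> : (\sum_i w i *: u i) y = \sum_i w i * u i y.
  rewrite sum_lfunE; by apply: eq_bigr => i _; rewrite lfunE.
rewrite -EFinB lee_fin -[b]mul1r -w1 mulr_suml -sumrB ler_sum// => i _.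
by rewrite -mulrBr ler_wpM2l// -lee_fin EFinB.
Qed.

(** * Weights and an elementary power inequality *)

Lemma weight_sumS (R : realType) (W : lmodType R) (alpha : nat -> R)
    (F : nat -> W) (k : nat) :
  \sum_(i < k.+1) weight alpha k.+1 i *: F i =
  (1 - alpha k) *: (\sum_(i < k) weight alpha k i *: F i) + alpha k *: F k.
Proof.
rewrite big_ord_recr/= eqxx scaler_sumr; congr (_ + _).
by apply: eq_bigr => i _; rewrite ltn_eqF// scalerA.
Qed.

Lemma weight_ge0 (R : realType) (alpha : nat -> R) (k i : nat) :
  (forall j, 0 <= alpha j <= 1) -> 0 <= weight alpha k i.
Proof.
move=> a01; elim: k => //= k IH; case: ifP => _; first by case/andP: (a01 k).
by rewrite mulr_ge0// subr_ge0; case/andP: (a01 k).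
Qed.

Lemma weight_sum1 (R : realType) (alpha : nat -> R) (k : nat) :
  alpha 0%N = 1 -> \sum_(i < k.+1) weight alpha k.+1 i = 1.
Proof.
(* The empty sum at index 0 is 0, so the total becomes 1 only through [alpha 0 = 1]; later steps
   preserve it. *)
move=> a0; elim: k => [|k IH]; first by rewrite big_ord1/= a0.
have := @weight_sumS R R^o alpha (fun=> 1) k.+1.
rewrite /GRing.scale/=; under eq_bigr do rewrite mulr1.
under [X in _ = _ * X + _]eq_bigr do rewrite mulr1.
by move=> ->; rewrite IH; lra.
Qed.

(** Both steps are [1 + z <= exp z]: at [z = - p / n], and at [z = 1 / n] to bound [exp (- 1 / n)]
    by [n / (n + 1)]. *)
Lemma powR_step_ge (R : realType) (n p : R) : 0 < n -> 0 <= p ->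
  1 - p / n <= (n / (n + 1)) `^ p.
Proof.
move=> n0 p0; apply: le_trans (expR_ge1Dx (- (p / n))) _.
rewrite (_ : - (p / n) = - n^-1 * p); last by ring.
have n1 : 0 < n + 1 by lra.
rewrite expRM ge0_ler_powR// ?nnegrE ?expR_ge0 ?divr_ge0 ?(ltW n0) ?(ltW n1)//.
rewrite expRN -[leRHS]invrK lef_pV2 ?posrE ?invr_gt0 ?divr_gt0 ?expR_gt0//.
apply: le_trans (expR_ge1Dx _); rewrite invf_div mulrDl divff ?gt_eqF//.
by rewrite mul1r.
Qed.

Lemma segmentE (R : realType) (V : lmodType R) (x s : V) (t : R) :
  x + t *: (s - x) = (1 - t) *: x + t *: s.
Proof. by rewrite scalerBr scalerBl scale1r addrA addrAC. Qed.

Lemma adjoint_sum (R : realType) (X Y : vectType R) (A : 'Hom(X, Y)) (k : nat)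
    (w : 'I_k -> R) (u : 'I_k -> dual Y) :
  - adjoint A (\sum_i w i *: u i) = \sum_i w i *: (- adjoint A (u i)).
Proof.
apply/lfunP => z; rewrite opp_lfunE comp_lfunE !sum_lfunE -sumrN.
by apply: eq_bigr => i _; rewrite !scale_lfunE opp_lfunE comp_lfunE scalerN.
Qed.

(** * Duality gap and convergence rate of the algorithm *)

Lemma conditional_subgradient_conjugates (R : realType) (X Y : vectType R)
    (A : 'Hom(X, Y)) (f : Y -> \bar R) (h : X -> \bar R)
    (df : Y -> dual Y) (dh : dual X -> X)
    (alpha : nat -> R) (x : nat -> X) (u : nat -> dual Y) (s : nat -> X) :
  proper_closed_convex f -> proper h ->
  oracles f h df dh -> compatible_oracles A f h df dh ->
  cond_subgrad_iterates A f df dh alpha x u s ->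
  exists a b : nat -> R, forall k,
    [/\ f (A (x k)) = (a k)%:E, h (s k) = (b k)%:E,
      conjugate f (u k) = ((u k (A (x k)) : R) - a k)%:E
    & conjugate h (- adjoint A (u k)) = (- (u k (A (s k)) : R) - b k)%:E].
Proof.
move=> hf hh [of_ oh] [cf _] hit.
exists (fun k => fine (f (A (x k)))), (fun k => fine (h (s k))) => k.
have [domf uE sE _ _] := hit k.
have := of_ _ domf; rewrite -uE => /(subdiff_conjugateE hf)[a fa cfa].
have := oh _ (cf _ domf); rewrite -uE -sE.
move=> /(subdiff_conj_conjugateE hh)[b hb chb].
by split; rewrite ?fa ?hb//=; rewrite chb opp_lfunE comp_lfunE//.
Qed.

(** The gap, with [hx] a real upper bound for [h (x k.+1)] and the dual values averaged by the
    weights, follows the same recursion as [G]. *)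
Lemma duality_gap_le (R : realType) (X Y : vectType R)
    (A : 'Hom(X, Y)) (f : Y -> \bar R) (h : X -> \bar R)
    (df : Y -> dual Y) (dh : dual X -> X)
    (alpha : nat -> R) (x : nat -> X) (u : nat -> dual Y) (s : nat -> X)
    (G : nat -> \bar R) (a b : nat -> R) :
  econvex h ->
  cond_subgrad_iterates A f df dh alpha x u s ->
  line_search A f df alpha x s G ->
  (forall k, f (A (x k)) = (a k)%:E) -> (forall k, h (s k) = (b k)%:E) ->
  forall k, exists hx g,
    [/\ (h (x k.+1) <= hx%:E)%E, G k.+1 = g%:E
    & a k.+1 + hx + \sum_(i < k.+1) weight alpha k.+1 i
        * (- a i - (u i (A (s i - x i)) : R) - b i) <= g].
Proof.
move=> cvxh hit [alpha0 G1 _ GS] fa hb.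
have bregE k : bregman f df (A (x k.+1)) (A (x k)) =
    (a k.+1 - a k - alpha k * (u k (A (s k - x k)) : R))%:E.
  have [_ uE _ _ xE] := hit k.
  have E : A (x k.+1) - A (x k) = alpha k *: A (s k - x k).
    by rewrite xE -segmentE linearD linearZ/= addrAC subrr add0r.
  by rewrite /bregman !fa -uE E linearZ -!EFinB.
(* By the Fenchel equalities this is the dual objective at [u i]. *)
pose d i := - a i - (u i (A (s i - x i)) : R) - b i.
elim=> [|k [hx [g [hhx Gg IH]]]].
  have [_ _ _ _ x1] := hit 0%N.
  have x1E : x 1%N = s 0%N by rewrite x1 alpha0 subrr scale0r add0r scale1r.
  exists (b 0%N), (a 1%N - a 0%N - alpha 0%N * (u 0%N (A (s 0%N - x 0%N)) : R)).
  rewrite x1E hb G1 -{1}x1E bregE; split => //.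
  by rewrite big_ord1/= alpha0; lra.
have [_ _ _ ak01 xE] := hit k.+1.
exists ((1 - alpha k.+1) * hx + alpha k.+1 * b k.+1),
  ((1 - alpha k.+1) * g
    + (a k.+2 - a k.+1 - alpha k.+1 * (u k.+1 (A (s k.+1 - x k.+1)) : R))).
split.
- have hs : (h (s k.+1) <= (b k.+1)%:E)%E by rewrite hb.
  have t01 : 0 <= 1 - alpha k.+1 <= 1 by case/andP: ak01; lra.
  by have := econvex_le cvxh t01 hhx hs; rewrite subKr -xE.
- by rewrite GS// -xE bregE Gg -EFinM -EFinD.
(* The terms in [b k.+1] cancel, leaving [1 - alpha k.+1] times the old gap plus exactly the Bregman
   term. *)
have := @weight_sumS R R^o alpha d k.+1; rewrite /GRing.scale/= => ->.
move/andP: ak01 => [ak0 ak1].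
have : (1 - alpha k.+1)
      * (a k.+1 + hx + \sum_(i < k.+1) weight alpha k.+1 i * d i)
    <= (1 - alpha k.+1) * g by rewrite ler_wpM2l// subr_ge0.
rewrite /d; lra.
Qed.

Lemma line_search_rate (R : realType) (X Y : vectType R)
    (A : 'Hom(X, Y)) (f : Y -> \bar R) (h : X -> \bar R)
    (df : Y -> dual Y) (dh : dual X -> X) (gamma C : R)
    (alpha : nat -> R) (x : nat -> X) (u : nat -> dual Y) (s : nat -> X)
    (G : nat -> \bar R) :
  compatible_oracles A f h df dh ->
  1 < gamma -> 0 <= C -> relative_curvature A f h df dh gamma C ->
  cond_subgrad_iterates A f df dh alpha x u s ->
  line_search A f df alpha x s G ->
  forall k, (G k.+1 <= (C * (gamma / (k.+1%:R + gamma)) `^ (gamma - 1))%:E)%E.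
Proof.
move=> [hc _] g1 C0 curv hit [alpha0 G1 amin GS].
have curvk k t : 0 <= t <= 1 ->
    (bregman f df (A (x k + t *: (s k - x k))%R) (A (x k))
      <= (C * t `^ gamma / gamma)%:E)%E.
  have [domf uE -> _ _] := hit k; rewrite uE.
  by apply: curv => //; exact: hc.
have step n : gamma <= n ->
    C * (gamma / n) `^ (gamma - 1) * (1 - (gamma - 1) / n) <=
    C * (gamma / (n + 1)) `^ (gamma - 1).
  move=> gn; have n0 : 0 < n by lra.
  have -> : gamma / (n + 1) = gamma / n * (n / (n + 1)).
    by field; apply/andP; split; lra.
  have gn0 : 0 <= gamma / n by apply: divr_ge0; lra.
  have nn0 : 0 <= n / (n + 1) by apply: divr_ge0; lra.
  rewrite (powRM _ gn0 nn0) mulrA ler_wpM2l ?mulr_ge0 ?powR_ge0//.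
  by apply: powR_step_ge; lra.
elim=> [|k IH].
  have := curvk 0%N 1; rewrite ler01 lexx scale1r addrC subrK powR1 -G1.
  move=> /(_ isT)/le_trans; apply; rewrite lee_fin.
  (* Curvature at step size 1 gives [G 1 <= C / gamma], the left side of [step] at [n = gamma]. *)
  have := step gamma (lexx _); rewrite divff ?powR1; last lra.
  have -> : 1 - (gamma - 1) / gamma = gamma^-1 by field; lra.
  by rewrite [1%:R + _]addrC.
pose n := k.+1%:R + gamma.
have k1 : 1 <= k.+1%:R :> R by rewrite ler1n.
have gn : gamma <= n by rewrite /n; lra.
have n0 : 0 < n by lra.
pose t := gamma / n.
have t01 : 0 <= t <= 1.
  by rewrite /t ler_pdivrMr// mul1r gn divr_ge0; lra.
(* The minimiser is compared with [t], for which [1 - t + t / gamma = 1 - (gamma - 1) / n], the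
   factor in [step]. *)
have [_ /(_ t t01) /=] := amin k.+1 isT.
rewrite (GS k.+1)// -segmentE => /le_trans; apply.
apply: le_trans (leeD (lee_wpmul2l _ IH) (curvk k.+1 t t01)) _.
  by rewrite lee_fin; lra.
rewrite -EFinM -EFinD lee_fin.
have -> : k.+2%:R + gamma = n + 1 by rewrite -[k.+2]addn1 natrD /n; ring.
apply: le_trans (step n gn); rewrite -/n -/t.
have tg : t `^ gamma = t * t `^ (gamma - 1).
  by rewrite mulr_powRB1//; lra.
rewrite tg le_eqVlt; apply/orP; left; apply/eqP; rewrite {1 3}/t.
by field; apply/andP; split; lra.
Qed.

Theorem proposition6 (R : realType) (X Y : vectType R) (A : 'Hom(X, Y))
    (f : Y -> \bar R) (h : X -> \bar R)
    (hf : proper_closed_convex f) (hh : proper_closed_convex h)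
    (df : Y -> dual Y) (dh : dual X -> X)
    (horacles : oracles f h df dh)
    (hcompat : compatible_oracles A f h df dh)
    (gamma C : R) (hgamma : 1 < gamma)
    (hcurv : relative_curvature A f h df dh gamma C)
    (alpha : nat -> R) (x : nat -> X) (u : nat -> dual Y) (s : nat -> X)
    (hiter : cond_subgrad_iterates A f df dh alpha x u s)
    (G : nat -> \bar R)
    (hsearch : line_search A f df alpha x s G) :
  forall k : nat, (1 <= k)%N ->
  forall uhat : dual Y,
    uhat = \sum_(i < k) weight alpha k i *: u i \/
    (exists2 i : nat, (i < k)%N &
       uhat = u i /\
       forall j : nat, (j < k)%N ->
         (dual_objective A f h (u i) <= dual_objective A f h (u j))%E) ->
  (f (A (x k)) + h (x k) + conjugate f uhat + conjugate h (- adjoint A uhat)%R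
     <= (C * (gamma / (k%:R + gamma)) `^ (gamma - 1))%:E)%E.
Proof.
have [[fny _] _ _] := hf; have [prh _ cvxh] := hh; have [hny _] := prh.
have [a [b vals]] :=
  conditional_subgradient_conjugates hf prh horacles hcompat hiter.
have fa k : f (A (x k)) = (a k)%:E by case: (vals k).
have hb k : h (s k) = (b k)%:E by case: (vals k).
pose cf k := (u k (A (x k)) : R) - a k.
pose ch k := - (u k (A (s k)) : R) - b k.
have cfE k : conjugate f (u k) = (cf k)%:E by case: (vals k).
have chE k : conjugate h (- adjoint A (u k)) = (ch k)%:E by case: (vals k).
(* The full first step has a Bregman distance that is nonnegative by Fenchel-Young and at most
   [C / gamma]. *)
have C0 : 0 <= C.
  have [d0 u0E s0E _ x1E] := hiter 0%N.
  have [alpha0 _ _ _] := hsearch.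
  have {}x1E : x 1%N = s 0%N by rewrite x1E alpha0 subrr scale0r add0r scale1r.
  have ds0 := hcompat.1 _ d0; rewrite -u0E in ds0.
  have := hcurv _ _ d0 ds0 1; rewrite ler01 lexx => /(_ isT).
  rewrite -s0E scale1r addrC subrK -x1E /bregman !fa -u0E powR1 mulr1.
  rewrite -!EFinB lee_fin linearB/= => bC.
  have : ((u 0%N (A (x 1%N)) : R)%:E - f (A (x 1%N)) <= conjugate f (u 0%N))%E.
    by apply: ereal_sup_ubound; exists (A (x 1%N)).
  rewrite fa cfE -EFinB lee_fin /cf => FY.
  have : 0 <= C / gamma by apply: le_trans bC; lra.
  by rewrite pmulr_lge0 ?invr_gt0//; lra.
case=> // k _ uhat huhat.
have alpha01 j : 0 <= alpha j <= 1 by case: (hiter j).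
have w0 (i : 'I_k.+1) : 0 <= weight alpha k.+1 i by exact: weight_ge0.
have w1 : \sum_(i < k.+1) weight alpha k.+1 i = 1.
  by apply: weight_sum1; case: hsearch.
have [hx [g [hhx Gg gap]]] := duality_gap_le cvxh hiter hsearch fa hb k.
have := line_search_rate hcompat hgamma C0 hcurv hiter hsearch k.
rewrite Gg lee_fin => rate.
(* Either choice of [uhat] does at least as well as the weighted average of the dual values: by
   Jensen for the averaged functional, and because a minimum is at most an average for the best
   one. *)
have [F [H [hF hH FH]]] : exists F H, [/\ (conjugate f uhat <= F%:E)%E,
    (conjugate h (- adjoint A uhat) <= H%:E)%E
  & F + H <= \sum_(i < k.+1) weight alpha k.+1 i * (cf i + ch i)].
  case: huhat => [->|[i ik [-> imin]]].
    exists (\sum_(i < k.+1) weight alpha k.+1 i * cf i),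
      (\sum_(i < k.+1) weight alpha k.+1 i * ch i); split.
    - by apply: conjugate_sum_le => // i; rewrite cfE.
    - by rewrite adjoint_sum; apply: conjugate_sum_le => // i; rewrite chE.
    - by under [leRHS]eq_bigr do rewrite mulrDr; rewrite big_split.
  exists (cf i), (ch i); split; rewrite ?cfE ?chE//.
  rewrite -[leLHS]mul1r -w1 mulr_suml ler_sum// => j _; rewrite ler_wpM2l//.
  have := imin j (ltn_ord j).
  by rewrite /dual_objective !cfE !chE -!EFinD lee_fin.
rewrite fa.
apply: (@le_trans _ _ ((a k.+1)%:E + hx%:E + F%:E + H%:E)%E).
  by rewrite !leeD.
have : \sum_(i < k.+1) weight alpha k.+1 i * (cf i + ch i) <=
    \sum_(i < k.+1) weight alpha k.+1 i
      * (- a i - (u i (A (s i - x i)) : R) - b i).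
  apply: ler_sum => i _; rewrite ler_wpM2l// /cf /ch (linearB A) linearB/=.
  lra.
by rewrite -!EFinD lee_fin; lra.
Qed.
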